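(* Let $n\ge 2$, let $m\in\{2,3,\dots,n\}$, and let $p\in\mathbb{C}[z_1,\dots,z_n]$ be a polynomial with no zeros in the open unit ball $\mathbb{B}_n$. Suppose that $\mathcal{Z}(p)\cap\mathbb{S}_n$ contains a real submanifold of $\mathbb{R}^{2n}$ of dimension $m-1$, but no submanifold of any higher dimension. Then $p$ is not cyclic in $D_\alpha(\mathbb{B}_n)$ whenever $\alpha>\frac{2n-(m-1)}{2}$.
   Context: Notation: $\|z\|=\sqrt{|z_1|^2+\dots+|z_n|^2}$ on $\mathbb{C}^n$; $\mathbb{B}_n=\{z\in\mathbb{C}^n:\|z\|<1\}$; $\mathbb{S}_n=\{z\in\mathbb{C}^n:\|z\|=1\}$; $\mathcal{Z}(p)=\{z\in\mathbb{C}^n:p(z)=0\}$. $\mathbb{C}^n$ is identified with $\mathbb{R}^{2n}$. Dirichlet-type spaces: for $\alpha\in\mathbb{R}$, $D_\alpha(\mathbb{B}_n)$ is the space of holomorphic functions $f(z)=\sum_{k}a_kz^k$ on $\mathbb{B}_n$ (sum over multi-indices $k=(k_1,\dots,k_n)$ of non-negative integers, with $|k|=k_1+\dots+k_n$, $k!=k_1!\cdots k_n!$, $z^k=z_1^{k_1}\cdots z_n^{k_n}$) such that $$\|f\|_\alpha^2:=\sum_{|k|=0}^{+\infty}(n+|k|)^\alpha\frac{(n-1)!\,k!}{(n-1+|k|)!}|a_k|^2<+\infty.$$ Cyclicity: $f\in D_\alpha(\mathbb{B}_n)$ is cyclic in $D_\alpha(\mathbb{B}_n)$ if the closure, in the norm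 of $D_\alpha(\mathbb{B}_n)$, of $\mathrm{span}\{z_1^{k_1}\cdots z_n^{k_n}f:k_1,\dots,k_n=0,1,2,\dots\}$ equals $D_\alpha(\mathbb{B}_n)$. *)

(* Defs.v *)
From mathcomp Require Import all_boot all_order all_algebra finmap.
From mathcomp Require Import all_classical all_reals all_analysis.
From mathcomp Require Import complex.
From mathcomp.analysis.showcase Require Import summability.
(* The notations of mpoly clash with those of mathcomp-analysis. *)
From mathcomp Require Import -(notations) mpoly.

Set Implicit Arguments.
Unset Strict Implicit.
Unset Printing Implicit Defensive.

Import Order.TTheory GRing.Theory Num.Theory.
Import numFieldNormedType.Exports.

Local Open Scope classical_set_scope.
Local Open Scope ring_scope.

(* Seen as a numClosedFieldType, R[i] inherits the norm and the topology that
   the library provides for abstract numeric fields. *)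
Definition Cplx (R : realType) : numClosedFieldType := R[i].

Section ComplexBall.
Variables (R : realType) (n : nat).
Local Notation C := (Cplx R).
Implicit Types (z : 'rV[C]_n) (k : multinom n).

(* The norm of 'rV[C]_n provided by the library is the maximum norm. *)
Definition enorm z : R :=
  Num.sqrt (\sum_(i < n) ComplexField.Normc.normc (z ord0 i) ^+ 2).

Definition cball : set 'rV[C]_n := [set z | enorm z < 1].

Definition csphere : set 'rV[C]_n := [set z | enorm z = 1].

Definition peval (p : mpoly n C) z : C :=
  meval (fun i => z ord0 i) p.

Definition zero_set (p : mpoly n C) : set 'rV[C]_n :=
  [set z | peval p z = 0].

Definition realify z : 'rV[R]_(n + n) :=
  row_mx (map_mx (@complex.Re R) z) (map_mx (@complex.Im R) z).

Definition zmonom k z : C := \prod_(i < n) z ord0 i ^+ k i.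

End ComplexBall.

Section Dirichlet.
Variables (R : realType) (n : nat).
Local Notation C := (Cplx R).
Implicit Types (f g h : 'rV[C]_n -> C) (a : multinom n -> C).

(* Elements of the function spaces are represented by total functions; their
   values outside the ball are irrelevant. *)
Definition holomorphic_on_ball f :=
  forall z, cball z -> differentiable f z.

(* f(z) = sum_k a_k z^k on the ball, as an unordered (that is, absolutely
   convergent) sum over all multi-indices. *)
Definition has_expansion f a :=
  forall z, cball z ->
    partial_sum (fun k => a k * zmonom k z) @ totally --> f z.

Definition dirichlet_weight (alpha : R) (k : multinom n) : R :=
  (n + mdeg k)%:R `^ alpha * ((n.-1)`! * \prod_(i < n) (k i)`!)%N%:R /
  ((n.-1 + mdeg k)`!)%:R.

Definition coef_norm (alpha : R) a : \bar R :=
  sqrte (\esum_(k in [set: multinom n])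
    (dirichlet_weight alpha k * ComplexField.Normc.normc (a k) ^+ 2)%:E)%E.

(* A function has at most one expansion on the ball, so the infimum is over at
   most one value; it is +oo when there is no expansion. *)
Definition dirichlet_norm (alpha : R) f : \bar R :=
  ereal_inf [set coef_norm alpha a | a in has_expansion f].

Definition dirichlet_space (alpha : R) : set ('rV[C]_n -> C) :=
  [set f | holomorphic_on_ball f /\ (dirichlet_norm alpha f < +oo)%E].

Definition monomial_span f : set ('rV[C]_n -> C) :=
  [set h | exists s : seq (C * multinom n),
     h = fun z => \sum_(ck <- s) ck.1 * (zmonom ck.2 z * f z)].

Definition dirichlet_closure (alpha : R) (S : set ('rV[C]_n -> C)) :
    set ('rV[C]_n -> C) :=
  [set g | dirichlet_space alpha g /\
     forall eps : R, 0 < eps ->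
       exists2 h, S h & (dirichlet_norm alpha (fun z => (g z - h z)%R)
                         < eps%:E)%E].

Definition cyclic_vector (alpha : R) f :=
  dirichlet_closure alpha (monomial_span f) = dirichlet_space alpha.

End Dirichlet.

Section Submanifold.
Variable R : realType.

Fixpoint Ck_on (d N : nat) (W : set 'rV[R]_d) (r : nat)
    (f : 'rV[R]_d -> 'rV[R]_N) : Prop :=
  if r is r'.+1 then
    (forall w, W w -> differentiable f w) /\
    (forall v, Ck_on W r' (fun w => 'D_v f w))
  else forall w, W w -> {for w, continuous f}.

Definition smooth_on (d N : nat) (W : set 'rV[R]_d)
    (f : 'rV[R]_d -> 'rV[R]_N) :=
  forall r, Ck_on W r f.

(* Nonempty embedded C^oo submanifolds of R^N of dimension d: near each of its
   points, M is the image of an open set of R^d under a smooth immersion psi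
   that is a homeomorphism onto its image, with inverse chi. The empty set is
   excluded, as it would be a submanifold of every dimension. *)
Definition submanifold (N d : nat) (M : set 'rV[R]_N) :=
  M !=set0 /\
  forall x, M x ->
    exists (U : set 'rV[R]_N) (W : set 'rV[R]_d)
           (psi : 'rV[R]_d -> 'rV[R]_N) (chi : 'rV[R]_N -> 'rV[R]_d),
      [/\ open U /\ U x,
          open W /\ psi @` W = M `&` U,
          smooth_on W psi,
          forall w, W w -> injective ('d psi w)
        & {within M `&` U, continuous chi} /\
          (forall w, W w -> chi (psi w) = w)].

End Submanifold.

(* Main.v *)
Require Import Defs.
From mathcomp Require Import all_boot all_order all_algebra.
From mathcomp Require Import finmap.
From mathcomp Require Import all_classical all_reals all_analysis.
From mathcomp Require Import complex.
From mathcomp.analysis.showcase Require Import summability.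
From mathcomp Require Import -(notations) mpoly.
From mathcomp Require Import ring lra zify.
Set Implicit Arguments.
Unset Strict Implicit.
Unset Printing Implicit Defensive.
Import Order.TTheory GRing.Theory Num.Theory.
Import numFieldNormedType.Exports.

(** A smooth measure mu on the submanifold M of the zero set of p on the sphere
    defines the functional sending f = sum_k a_k z^k to
    int f dmu = sum_k a_k mu^(k), where mu^(k) = int z^k dmu.  It kills all
    polynomial multiples of p, because p = 0 on M, but it does not kill the
    constant 1.  If it is bounded on the Dirichlet-type space, then 1 is not in
    the closure of the multiples of p, and p is not cyclic.

    With w_k the weight of the space and d = dim M, boundedness means that
    sum_k |mu^(k)|^2 / w_k is finite.  Grouping the multi-indices by their degree
    N, the multinomial theorem turns this sum into
    sum_N (n+N)^(-alpha) B_N, where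
    B_N = binom(N+n-1, n-1) int int <z,w>^N dmu dmu
    is the N-th part of the energy of the Szego kernel (1 - <z,w>)^(-n).  On the
    sphere Re (1 - <z,w>) = |z-w|^2 / 2; hence the Szego kernel, with
    its geometric series cut off at L, is at most a constant times (1/L + |z-w|^2)^(-n), and its energy on
    a d-dimensional set is O(L^(n - d/2)).  So B_0 + ... + B_(L-1) is
    O(L^(n - d/2)), and a dyadic decomposition gives convergence as soon as
    alpha > n - d/2.

    The measure is discretised, so that only finite sums occur: mu is replaced by
    the uniform measure on the image under a chart of a grid with G^d points.  Its
    energy behaves as that of a d-dimensional measure for degrees up to G^2.
    Functions of the space are evaluated at radius rho < 1, which damps the
    higher degrees; G is chosen after rho, and the energy bound does not depend
    on rho.  The lemmas that carry the proof are [szego_energy_le] (moments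
    against kernel), [grid_energy_le] (kernel energy of a grid), [dyadic_sum_le],
    [riesz_energy_le] (uniform energy bound), [submanifold_bilipschitz_chart]
    (a chart that does not contract distances too much),
    [monomial_span_radial_le] (multiples of p are uniformly small near M) and
    [dual_pairing_le] (duality). *)

Local Open Scope classical_set_scope.
Local Open Scope ring_scope.

Local Notation normc := ComplexField.Normc.normc.
#[local] Existing Instance totally_filter.

(** * Moments and the energy of the Szego kernel *)

(** The multinomial theorem.  Differentiating in a variable that occurs in k lowers
    the degree by one, and the derivative of S^(N+1) is (N+1) S^N for S = sum_i X_i;
    so the coefficients of degree N+1 follow from those of degree N. *)
Lemma mcoeff_sumX_exp (C : numFieldType) n (k : multinom n) :
  mcoeff k ((\sum_(i < n) mpolyX C (mnm1 i)) ^+ mdeg k) =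
  (mdeg k)`!%:R / (\prod_(i < n) (k i)`!)%:R :> C.
Proof.
have [N] := ubnP (mdeg k); elim: N k => // N IH k.
have [/eqP|kn0 hk] := eqVneq (mdeg k) 0%N.
  rewrite mdeg_eq0 => /eqP -> _; rewrite mdeg0 expr0 mcoeff1 eqxx.
  by rewrite big1 ?divr1 // => i _; rewrite mnm0E.
have /existsP[i ki] : [exists i, k i != 0%N].
  apply: contraR kn0; rewrite negb_exists => /forallP kz.
  by rewrite mdegE big1 // => i _; apply/eqP; move: (kz i); rewrite negbK.
pose k' := mnm_sub k (mnm1 i).
have kE : k = mnm_add k' (mnm1 i).
  apply/mnmP => j; rewrite mnmDE mnmBE mnm1E.
  by case: eqP => [<-|_]; rewrite ?subn0 ?addn0 // subnK // lt0n.
have dk : mdeg k = (mdeg k').+1 by rewrite [in LHS]kE mdegD mdeg1 addn1.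
have := IH k'; rewrite -ltnS -dk => /(_ hk) IHk.
have derX M : mderiv i ((\sum_(j < n) mpolyX C (mnm1 j)) ^+ M.+1) =
              ((\sum_(j < n) mpolyX C (mnm1 j)) ^+ M) *+ M.+1.
  have d1 : mderiv i (\sum_(j < n) mpolyX C (mnm1 j)) = 1.
    rewrite raddf_sum (bigD1 i) //= big1 ?addr0 => [|j ji]; rewrite mderivX mnm1E.
      rewrite eqxx scale1r (_ : mnm_sub _ _ = mnm0) ?mpolyX0 //.
      by apply/mnmP => l; rewrite mnmBE mnm0E subnn.
    by rewrite (negbTE ji) scale0r.
  elim: M => [|M IHM]; first by rewrite expr1 d1 expr0 mulr1n.
  by rewrite exprS mderivM d1 IHM mul1r mulrnAr -exprS -mulrS.
have := congr1 (mcoeff k') (derX (mdeg k')).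
rewrite mcoeff_deriv mcoeffMn IHk -kE -[X in _ ^+ X]dk => e.
have -> : (\prod_(j < n) (k j)`!)%N = ((\prod_(j < n) (k' j)`!) * (k' i).+1)%N.
  rewrite (bigD1 i) //= [in RHS](bigD1 i) //= mulnAC; congr (_ * _)%N.
    by rewrite kE mnmDE mnm1E eqxx addn1 factS mulnC.
  by apply: eq_bigr => j ji; rewrite kE mnmDE mnm1E eq_sym (negbTE ji) addn0.
have nz : (k' i).+1%:R != 0 :> C by rewrite pnatr_eq0.
apply: (mulIf nz); rewrite mulr_natr e dk factS !natrM invfM -mulr_natl.
by rewrite -!mulrA mulVf // mulr1 [RHS]mulr_natl.
Qed.

Lemma dhomog_sumX_exp (C : numFieldType) n N (k : multinom n) :
  k \in msupp ((\sum_(i < n) mpolyX C (mnm1 i)) ^+ N) -> mdeg k = N.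
Proof.
apply: dhomog_mf.
rewrite -[X in ishomog1 X _]mul1n; apply: dhomogMn.
by apply: rpred_sum => i _; rewrite dhomogX; apply/eqP; apply: mdeg1.
Qed.

(** Expanding <z_u, z_v>^N by the multinomial theorem separates u from v, and the
    double sum over u and v becomes a combination with nonnegative coefficients of
    squared moments; keeping only the moments indexed by s decreases it. *)
Lemma sum_multinomial_moments_le (C : numClosedFieldType) (V : finType) n
    (z : V -> 'I_n -> C) N (s : seq (multinom n)) : uniq s ->
  {in s, forall k, mdeg k = N} ->
  \sum_(k <- s) N`!%:R / (\prod_(i < n) (k i)`!)%:R *
     `|\sum_v \prod_(i < n) z v i ^+ k i| ^+ 2 <=
  \sum_u \sum_v (\sum_(i < n) z u i * (z v i)^*) ^+ N.
Proof.
move=> us sN; set S := (\sum_(i < n) mpolyX C (mnm1 i)) ^+ N.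
pose F (k : multinom n) : C := N`!%:R / (\prod_(i < n) (k i)`!)%:R *
     `|\sum_v \prod_(i < n) z v i ^+ k i| ^+ 2.
have F0 k : 0 <= F k by rewrite mulr_ge0 ?divr_ge0 ?exprn_ge0.
have -> : \sum_u \sum_v (\sum_(i < n) z u i * (z v i)^*) ^+ N =
          \sum_(k <- msupp S) F k.
  transitivity (\sum_u \sum_v meval (fun i => z u i * (z v i)^*) S).
    apply: eq_bigr => u _; apply: eq_bigr => v _.
    rewrite /S rmorphXn raddf_sum /=; congr (_ ^+ _).
    by apply: eq_bigr => i _; rewrite mevalXU.
  under eq_bigr do under eq_bigr do rewrite mevalE.
  under eq_bigr do rewrite exchange_big /=.
  rewrite exchange_big /= !big_seq; apply: eq_bigr => k /[dup] /dhomog_sumX_exp dk.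
  rewrite /S -{2}dk mcoeff_sumX_exp dk /F => _.
  rewrite normCK rmorph_sum /= big_distrlr /= mulr_sumr; apply: eq_bigr => u _.
  rewrite mulr_sumr; apply: eq_bigr => v _; congr (_ * _).
  rewrite rmorph_prod -big_split /=; apply: eq_bigr => i _.
  by rewrite exprMn rmorphXn.
have sub : {subset s <= msupp S}.
  move=> k /sN dk; rewrite mcoeff_msupp /S -dk mcoeff_sumX_exp.
  by rewrite mulf_neq0 ?invr_eq0 ?pnatr_eq0 -?lt0n ?fact_gt0 // prodn_gt0 // => i;
     rewrite fact_gt0.
rewrite [X in _ <= X](bigID (mem s)) /= -[X in X <= _]addr0 lerD ?sumr_ge0 //.
rewrite -[X in _ <= X]big_filter le_eqVlt; apply/orP; left; apply/eqP.
apply: perm_big; apply: uniq_perm => //; first by rewrite filter_uniq ?msupp_uniq.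
by move=> k; rewrite mem_filter; case ks: (k \in s) => //=; rewrite sub.
Qed.

Lemma sum_bin_diag N j : (\sum_(i < N.+1) 'C(i + j, j))%N = 'C(N + j.+1, j.+1).
Proof.
elim: N => [|N IH]; first by rewrite big_ord1 !add0n !binn.
by rewrite big_ord_recr /= IH addSnnS [in RHS]addSn binS.
Qed.

(** Below degree L, the powers of the truncated geometric series have the coefficients
    of those of 1/(1-X).  Unlike the latter, they are polynomials, bounded on the
    closed unit disc. *)
Lemma coef_geom_exp (C : numDomainType) L j N : (N < L)%N ->
  ((\sum_(i < L) 'X^i) ^+ j.+1 : {poly C})`_N = 'C(N + j, j)%:R.
Proof.
elim: j N => [|j IH] N NL.
  rewrite expr1 addn0 bin0 coef_sum (bigD1 (Ordinal NL)) //= coefXn eqxx.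
  by rewrite big1 ?addr0 // => i; rewrite -val_eqE eq_sym /= coefXn => /negbTE ->.
rewrite exprSr coefM -sum_bin_diag natr_sum; apply: eq_bigr => i _.
have iL : (i < L)%N by rewrite (leq_ltn_trans _ NL) // -ltnS.
rewrite IH // coef_sum (bigD1 (Ordinal (leq_ltn_trans (leq_subr i N) NL))) //=.
rewrite coefXn eqxx big1 ?addr0 ?mulr1 // => l.
by rewrite -val_eqE eq_sym /= coefXn => /negbTE ->.
Qed.

Lemma coef_geom_exp_ge0 (C : numDomainType) L j N :
  0 <= ((\sum_(i < L) 'X^i) ^+ j : {poly C})`_N.
Proof.
elim: j N => [|j IH] N; first by rewrite expr0 coef1 ler0n.
rewrite exprS coefM sumr_ge0 // => i _; rewrite mulr_ge0 // coef_sum sumr_ge0 // => l _.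
by rewrite coefXn ler0n.
Qed.

(** The right-hand side is the energy of the truncated Szego kernel.  Its expansion in
    powers of <z_u, z_v> has nonnegative coefficients, and those of degree below L
    are the coefficients of (1-x)^(-n). *)
Lemma szego_energy_le (C : numClosedFieldType) (V : finType) n
    (z : V -> 'I_n -> C) L (s : seq (multinom n)) : (0 < n)%N -> uniq s ->
  {in s, forall k, (mdeg k < L)%N} ->
  \sum_(k <- s) 'C(mdeg k + n.-1, n.-1)%:R *
     ((mdeg k)`!%:R / (\prod_(i < n) (k i)`!)%:R *
     `|\sum_v \prod_(i < n) z v i ^+ k i| ^+ 2) <=
  \sum_u \sum_v (\sum_(j < L) (\sum_(i < n) z u i * (z v i)^*) ^+ j) ^+ n.
Proof.
move=> n0 us sL; set g : {poly C} := (\sum_(j < L) 'X^j) ^+ n.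
pose M := maxn (size g) L.
pose F (k : multinom n) : C := (mdeg k)`!%:R / (\prod_(i < n) (k i)`!)%:R *
     `|\sum_v \prod_(i < n) z v i ^+ k i| ^+ 2.
pose x u v := \sum_(i < n) z u i * (z v i)^*.
have -> : \sum_u \sum_v (\sum_(j < L) x u v ^+ j) ^+ n =
          \sum_(N < M) g`_N * (\sum_u \sum_v x u v ^+ N).
  transitivity (\sum_u \sum_v g.[x u v]).
    apply: eq_bigr => u _; apply: eq_bigr => v _.
    rewrite /g horner_exp horner_sum; congr (_ ^+ _).
    by apply: eq_bigr => i _; rewrite hornerXn.
  under [RHS]eq_bigr do (rewrite mulr_sumr; under eq_bigr do rewrite mulr_sumr).
  rewrite [RHS]exchange_big; apply: eq_bigr => u _ /=.
  rewrite [RHS]exchange_big; apply: eq_bigr => v _ /=.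
  by rewrite (@horner_coef_wide _ M) // leq_maxl.
apply: (@le_trans _ _ (\sum_(N < M) g`_N * (\sum_(k <- s | mdeg k == N) F k))); last first.
  apply: ler_sum => N _; apply: ler_wpM2l; first exact: coef_geom_exp_ge0.
  rewrite -big_filter.
  have := @sum_multinomial_moments_le C V n z N [seq k <- s | mdeg k == N].
  rewrite filter_uniq // => /(_ isT).
  have h : {in [seq k <- s | mdeg k == N], forall k, mdeg k = N}.
    by move=> k; rewrite mem_filter => /andP[/eqP].
  move=> /(_ h); apply: le_trans; rewrite le_eqVlt; apply/orP; left; apply/eqP.
  by rewrite big_seq [RHS]big_seq; apply: eq_bigr => k /h <-.
under [leRHS]eq_bigr do rewrite mulr_sumr.
rewrite (exchange_big_dep predT) //= big_seq [leRHS]big_seq ler_sum // => k ks.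
have kM : (mdeg k < M)%N by rewrite (leq_trans (sL _ ks)) // leq_maxr.
rewrite (big_pred1 (Ordinal kM)); last by move=> N /=; rewrite -val_eqE eq_sym.
have -> : g = (\sum_(j < L) 'X^j) ^+ n.-1.+1 by rewrite prednK.
by rewrite coef_geom_exp ?sL.
Qed.

(** * The truncated kernel on the unit sphere *)

(** The sum is bounded both by L and by 2/|1-x|; this form contains both bounds. *)
Lemma geom_sum_norm_le (C : numFieldType) (x : C) L : (0 < L)%N -> `|x| <= 1 ->
  `|\sum_(j < L) x ^+ j| * (L%:R^-1 + `|1 - x|) <= 3.
Proof.
move=> L0 x1; rewrite mulrDr (_ : 3 = 1 + 2 :> C); last by ring.
apply: lerD.
  rewrite ler_pdivrMr ?ltr0n // mul1r (le_trans (ler_norm_sum _ _ _)) //.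
  rewrite (le_trans (ler_sum _ (G := fun=> 1) _)) ?sumr_const ?card_ord // => i _.
  by rewrite normrX exprn_ile1.
rewrite -normrM mulrC -opprB mulNr -subrX1 normrN (le_trans (ler_normB _ _)) //.
by rewrite normr1 normrX (_ : 2 = 1 + 1 :> C) ?lerD ?exprn_ile1 //; ring.
Qed.

Section UnitVectors.
Variables (C : numClosedFieldType) (n : nat) (z w : 'I_n -> C).
Hypotheses (z1 : \sum_i `|z i| ^+ 2 = 1) (w1 : \sum_i `|w i| ^+ 2 = 1).
Let x := \sum_i z i * (w i)^*.

(** On the unit sphere |z-w|^2 = 2 Re (1 - <z,w>): the kernel can be singular only on
    the diagonal, at a rate controlled by the Euclidean distance. *)
Lemma sum_sqr_dist_le : \sum_i `|z i - w i| ^+ 2 <= 2 * `|1 - x|.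
Proof.
have -> : \sum_i `|z i - w i| ^+ 2 = `|(1 - x) + (1 - x)^*|.
  rewrite -[LHS]ger0_norm; last by apply: sumr_ge0 => i _; rewrite exprn_ge0.
  congr `|_|; rewrite rmorphB rmorph1 /x rmorph_sum -{1}z1 -{1}w1 -!sumrB -big_split /=.
  apply: eq_bigr => i _; rewrite !normCK rmorphB rmorphM /= conjCK; ring.
by rewrite (le_trans (ler_normD _ _)) // norm_conjC mulr2n mulrDl mul1r.
Qed.

Lemma norm_inner_le1 : `|x| <= 1.
Proof.
rewrite /x (le_trans (ler_norm_sum _ _ _)) //.
have -> : 1 = \sum_i (`|z i| ^+ 2 + `|w i| ^+ 2) / 2 :> C.
  by rewrite -mulr_suml big_split /= z1 w1; field.
apply: ler_sum => i _; rewrite normrM norm_conjC ler_pdivlMr ?ltr0n //.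
rewrite -subr_ge0 (_ : _ - _ = (`|z i| - `|w i|) ^+ 2); last by ring.
by rewrite real_exprn_even_ge0 // rpredB // normr_real.
Qed.

End UnitVectors.

Section OneDim.
Variable R : realFieldType.

(** A Riemann sum of step e for the integral of 1/(1+x^2) over the half-line.  The
    bound telescopes after comparing 1/(1+x^2) with 2/(1+x)^2. *)
Lemma sum_cauchy_density_le (e : R) T : 0 <= e -> e <= 1 ->
  \sum_(t < T) e / (1 + e ^+ 2 * t%:R ^+ 2) <= 3.
Proof.
move=> e0 e1.
have key m : 0 <= m -> e / (1 + e ^+ 2 * (m + 1) ^+ 2) <=
    2 * ((1 + e * m)^-1 - (1 + e * (m + 1))^-1).
  move=> m0; have em : 0 <= e * m by rewrite mulr_ge0.
  have a0 : 0 < 1 + e * m by lra.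
  have b0 : 0 < 1 + e * (m + 1) by nra.
  have -> : 2 * ((1 + e * m)^-1 - (1 + e * (m + 1))^-1) =
            2 * e / ((1 + e * m) * (1 + e * (m + 1))).
    by field; rewrite !gt_eqF.
  have c0 : 0 < 1 + e ^+ 2 * (m + 1) ^+ 2 by nra.
  rewrite ler_pdivrMr // mulrAC ler_pdivlMr ?mulr_gt0 //.
  rewrite -subr_ge0.
  set D := (X in 0 <= X).
  have -> : D = e * (2 * (1 + e ^+ 2 * (m + 1) ^+ 2) - (1 + e * m) * (1 + e * (m + 1))).
    by rewrite /D; ring.
  rewrite mulr_ge0 // subr_ge0.
  set y := e * m in em *; have -> : e * (m + 1) = y + e by rewrite /y; ring.
  have -> : e ^+ 2 * (m + 1) ^+ 2 = (y + e) ^+ 2 by rewrite /y; ring.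
  have := sqr_ge0 (1 - (y + e)); have : 0 <= (1 + (y + e)) * e by rewrite mulr_ge0 //; lra.
  lra.
have H : \sum_(t < T) e / (1 + e ^+ 2 * t%:R ^+ 2) <= 1 + 2 * (1 - (1 + e * (T.-1)%:R)^-1).
  elim: T => [|[|T] IH].
  - by rewrite big_ord0 /= mulr0 addr0 invr1 subrr mulr0 addr0.
  - rewrite big_ord1 /= expr0n /= !mulr0 addr0 !divr1; lra.
  rewrite big_ord_recr /=; have := key _ (ler0n R T); move: IH => /=; rewrite natr1; lra.
apply: (le_trans H); have : 0 <= (1 + e * (T.-1)%:R)^-1.
  by rewrite invr_ge0 addr_ge0 // mulr_ge0.
lra.
Qed.
End OneDim.

(** * Energy of a grid *)

(** The one-dimensional energy: the integral of (1/ell^2 + c x^2)^(-1) is of order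
    ell, and a grid of step 1/G <= 1/ell is fine enough to see it. *)
Lemma grid_line_sum_le (R : realFieldType) (c : R) (ell G : nat) (a : 'I_G) :
  0 < c -> c <= 1 -> (0 < ell <= G)%N ->
  \sum_(w < G) ((ell%:R ^+ 2)^-1 + c * (((a : nat)%:R - (w : nat)%:R) / G%:R) ^+ 2)^-1
   <= 6 / c * ell%:R * G%:R.
Proof.
move=> c0 c1 /andP[l0 lG]; have G0 : (0 < G)%N by apply: leq_trans lG.
(* The step of the grid, measured at the scale 1 / ell. *)
pose e : R := ell%:R / G%:R.
have lR : 0 < ell%:R :> R by rewrite ltr0n.
have GR : 0 < G%:R :> R by rewrite ltr0n.
have e0 : 0 <= e by rewrite divr_ge0.
have e1 : e <= 1 by rewrite ler_pdivrMr // mul1r ler_nat.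
pose g (t : nat) : R := e / (1 + e ^+ 2 * t%:R ^+ 2).
have g0 t : 0 <= g t by rewrite divr_ge0 // addr_ge0 // mulr_ge0 ?sqr_ge0 ?exprn_ge0.
pose f (t : nat) := c^-1 * ell%:R * G%:R * g t.
have fle (w : 'I_G) (t : nat) : (((a : nat)%:R - (w : nat)%:R) ^+ 2 = t%:R ^+ 2 :> R) ->
  ((ell%:R ^+ 2)^-1 + c * (((a : nat)%:R - (w : nat)%:R) / G%:R) ^+ 2)^-1 <= f t.
  move=> tE; rewrite exprMn tE /f /g /e exprVn.
  set T : R := t%:R ^+ 2; have T0 : 0 <= T by rewrite exprn_ge0.
  set l : R := ell%:R in lR *; set K : R := G%:R in GR *.
  have den : 0 < 1 + (l / K) ^+ 2 * T by rewrite ltr_wpDr // mulr_ge0 // sqr_ge0.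
  have -> : c^-1 * l * K * (l / K / (1 + (l / K) ^+ 2 * T)) =
            (c * ((l ^+ 2)^-1 + T * (K ^+ 2)^-1))^-1.
    by field; rewrite !gt_eqF //=; nra.
  have l2 : 0 < (l ^+ 2)^-1 by rewrite invr_gt0 exprn_gt0.
  have K2 : 0 <= T * (K ^+ 2)^-1 by rewrite mulr_ge0 // invr_ge0 exprn_ge0 // ltW.
  rewrite lef_pV2 ?posrE; [|nra|nra].
  nra.
apply: (@le_trans _ _ (\sum_(w < G) (if (w <= a)%N then f (a - w)%N else f (w - a)%N))).
  apply: ler_sum => w _; case: leqP => wa; apply: fle.
    by rewrite natrB.
  by rewrite natrB 1?ltnW // -sqrrN opprB.
have f0 t : 0 <= f t by rewrite mulr_ge0 // !mulr_ge0 ?invr_ge0 // ltW.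
have sumf T : \sum_(t < T) f t <= 3 / c * ell%:R * G%:R.
  rewrite -mulr_sumr (_ : 3 / c * _ * _ = c^-1 * ell%:R * G%:R * 3); last by ring.
  apply: ler_wpM2l; first by rewrite !mulr_ge0 ?invr_ge0 // ltW.
  exact: sum_cauchy_density_le.
rewrite (bigID (fun w : 'I_G => (w <= a)%N)) /=.
have -> : 6 / c * ell%:R * G%:R = 3 / c * ell%:R * G%:R + 3 / c * ell%:R * G%:R by ring.
apply: lerD.
  rewrite (eq_bigr (fun w : 'I_G => f (a - w)%N)) => [|w ->] //.
  apply: le_trans (sumf a.+1).
  rewrite -(big_mkord (fun w => w <= a)%N (fun w => f (a - w)%N)).
  rewrite (big_cat_nat _ (n := a.+1)) //=.
  rewrite [X in _ + X]big_nat_cond [X in _ + X]big1 ?addr0; last first.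
    by move=> w /andP[/andP[aw _] wa]; move: aw; rewrite ltnNge wa.
  rewrite big_nat_rev /= big_mkord.
  rewrite [leLHS]big_mkcond; apply: ler_sum => w _ /=.
  case: ifP => _ //; rewrite add0n subSS subKn // -ltnS; exact: ltn_ord.
rewrite (eq_bigr (fun w : 'I_G => f (w - a)%N)) => [|w /negbTE ->] //.
apply: le_trans (sumf (G - a)%N).
rewrite -(big_mkord (fun w => ~~ (w <= a))%N (fun w => f (w - a)%N)).
rewrite (big_cat_nat _ (n := a)) //= 1?ltnW //.
rewrite [X in X + _]big_nat_cond [X in X + _]big1 ?add0r; last first.
  by move=> w /andP[/andP[_ aw]]; rewrite ltnW.
rewrite -{1}[X in \sum_(X <= _ < _ | _) _]add0n big_addn big_mkord.
rewrite [leLHS]big_mkcond; apply: ler_sum => w _ /=.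
by case: ifP => _ //; rewrite addnK.
Qed.

Section Grid.
Variables (R : rcfType).
Local Notation C := R[i].

Lemma normcE (x : C) : `|x| = (normc x)%:C%C.
Proof. by rewrite normc_def; case: x. Qed.

Lemma normc_ge0 (x : C) : 0 <= normc x.
Proof. by case: x => a b; apply: sqrtr_ge0. Qed.

(** The coefficient of z^k (conjugate w)^k in the Szego kernel (1 - <z,w>)^(-n). *)
Definition szego_coef n (k : multinom n) : R :=
  'C(mdeg k + n.-1, n.-1)%:R * ((mdeg k)`!%:R / (\prod_(i < n) (k i)`!)%:R).

Lemma szego_coef_ge0 n (k : multinom n) : 0 <= szego_coef k.
Proof. by rewrite mulr_ge0 // divr_ge0. Qed.

Lemma szego_energy_normc_le (V : finType) n
    (z : V -> 'I_n -> C) L (s : seq (multinom n)) : (0 < n)%N -> uniq s ->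
  {in s, forall k, (mdeg k < L)%N} ->
  \sum_(k <- s) szego_coef k * normc (\sum_v \prod_(i < n) z v i ^+ k i) ^+ 2 <=
  \sum_u \sum_v normc (\sum_(j < L) (\sum_(i < n) z u i * (z v i)^*) ^+ j) ^+ n.
Proof.
move=> n0 us sL; rewrite -lecR.
have := szego_energy_le z n0 us sL.
set A := (X in X <= _ -> _); set B := (X in _ <= X -> _) => AB.
have -> : (\sum_(k <- s) szego_coef k *
   normc (\sum_v \prod_(i < n) z v i ^+ k i) ^+ 2)%:C%C = A.
  rewrite rmorph_sum; apply: eq_bigr => k _.
  rewrite rmorphM rmorphXn /= -normcE /szego_coef !rmorphM /= !rmorph_nat fmorphV.
  by rewrite rmorph_nat !mulrA.
have B0 : 0 <= B.
  by apply: le_trans AB; apply: sumr_ge0 => k _; rewrite !mulr_ge0 ?exprn_ge0 ?invr_ge0.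
apply: (le_trans AB); rewrite -(ger0_norm B0) /B rmorph_sum.
rewrite (le_trans (ler_norm_sum _ _ _)) //; apply: ler_sum => u _.
rewrite rmorph_sum (le_trans (ler_norm_sum _ _ _)) //; apply: ler_sum => v _.
by rewrite normrX rmorphXn /= -normcE.
Qed.

Lemma geom_inner_normc_le n (z w : 'I_n -> C) L : (0 < L)%N ->
  \sum_i normc (z i) ^+ 2 = 1 -> \sum_i normc (w i) ^+ 2 = 1 ->
  normc (\sum_(j < L) (\sum_i z i * (w i)^*) ^+ j) *
    (L%:R^-1 + (\sum_i normc (z i - w i) ^+ 2) / 2) <= 3.
Proof.
move=> L0 z1 w1.
have conv (y : 'I_n -> C) : (\sum_i normc (y i) ^+ 2)%:C%C = \sum_i `|y i| ^+ 2.
  by rewrite rmorph_sum; apply: eq_bigr => i _; rewrite rmorphXn /= -normcE.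
have z1' : \sum_i `|z i| ^+ 2 = 1 by rewrite -conv z1.
have w1' : \sum_i `|w i| ^+ 2 = 1 by rewrite -conv w1.
rewrite -lecR !rmorphM rmorphD rmorphM /= -normcE !fmorphV !rmorph_nat conv.
apply: le_trans (geom_sum_norm_le L0 (norm_inner_le1 z1' w1')).
rewrite ler_wpM2l // lerD2l ler_pdivrMr ?ltr0n // mulrC.
exact: sum_sqr_dist_le.
Qed.

(** The kernel is at most 3 / (1/ell^2 + D) for every lower bound D of |z-w|^2 / 2.
    Of the n factors of its n-th power, n-d are bounded by 3 ell^2, and one factor is
    used for each of the d directions of the grid; the double sum over the grid then
    splits into a product of one-dimensional sums, each of order ell G. *)
Lemma grid_energy_le n d G ell (c : R) (z : {ffun 'I_d -> 'I_G} -> 'I_n -> C)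
    (s : seq (multinom n)) :
  (0 < n)%N -> (d <= n)%N -> 0 < c -> c <= 1 -> (0 < ell <= G)%N ->
  (forall v, \sum_i normc (z v i) ^+ 2 = 1) ->
  (forall (u v : {ffun 'I_d -> 'I_G}) l, c * (((u l : nat)%:R - (v l : nat)%:R) / G%:R) ^+ 2 <=
     (\sum_i normc (z u i - z v i) ^+ 2) / 2) ->
  uniq s -> {in s, forall k, (mdeg k < ell ^ 2)%N} ->
  \sum_(k <- s) szego_coef k * normc (\sum_v \prod_(i < n) z v i ^+ k i) ^+ 2 <=
  3 ^+ n * (6 / c) ^+ d * ell%:R ^+ (2 * n - d) * (G%:R ^+ d) ^+ 2.
Proof.
move=> n0 dn c0 c1 /andP[l0 lG] z1 zd us sL.
have G0 : (0 < G)%N by apply: leq_trans lG.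
have l20 : (0 < ell ^ 2)%N by rewrite expn_gt0 l0.
apply: le_trans (szego_energy_normc_le z n0 us sL) _.
pose f (a b : 'I_G) : R :=
  ((ell%:R ^+ 2)^-1 + c * (((a : nat)%:R - (b : nat)%:R) / G%:R) ^+ 2)^-1.
have lR : 0 < ell%:R :> R by rewrite ltr0n.
have il2 : 0 < (ell%:R ^+ 2)^-1 :> R by rewrite invr_gt0 exprn_gt0.
have f0 a b : 0 < f a b.
  by rewrite invr_gt0 ltr_pwDl // mulr_ge0 ?sqr_ge0 // ltW.
pose K u v := normc (\sum_(j < ell ^ 2) (\sum_(i < n) z u i * (z v i)^*) ^+ j).
have K0 u v : 0 <= K u v by apply: normc_ge0.
have Kge u v D : 0 < D -> D <= (ell%:R ^+ 2)^-1 + (\sum_i normc (z u i - z v i) ^+ 2) / 2 ->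
    K u v <= 3 * D^-1.
  move=> D0 Dle; rewrite ler_pdivlMr //.
  apply: le_trans (geom_inner_normc_le l20 (z1 u) (z1 v)).
  by rewrite natrX ler_wpM2l.
have Kn u v : K u v ^+ n <= 3 ^+ n * ell%:R ^+ (2 * (n - d)) * \prod_(l < d) f (u l) (v l).
  have -> : 3 ^+ n * ell%:R ^+ (2 * (n - d)) * \prod_(l < d) f (u l) (v l) =
     (3 * ell%:R ^+ 2) ^+ (n - d) * \prod_(l < d) (3 * f (u l) (v l)).
    rewrite big_split /= prodr_const card_ord [in RHS]exprMn -exprM.
    rewrite -{1}(subnK dn) exprD; ring.
  rewrite -{1}(subnK dn) exprD.
  rewrite ler_pM ?exprn_ge0 //.
    rewrite lerXn2r ?nnegrE ?mulr_ge0 ?exprn_ge0 //.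
    rewrite -[ell%:R ^+ 2]invrK; apply: Kge => //.
    by rewrite lerDl divr_ge0 // sumr_ge0 // => i _; rewrite exprn_ge0 // normc_ge0.
  rewrite -[X in _ ^+ X]card_ord -prodr_const ler_prod // => l _.
  by rewrite K0 /=; apply: Kge; [rewrite -invr_gt0; apply: f0|rewrite lerD2l].
apply: (@le_trans _ _ (\sum_(u : {ffun 'I_d -> 'I_G}) 3 ^+ n * ell%:R ^+ (2 * (n - d)) *
     (6 / c * ell%:R * G%:R) ^+ d)).
  apply: ler_sum => u _; apply: (le_trans (ler_sum _ (fun v _ => Kn u v))).
  rewrite -mulr_sumr ler_wpM2l ?mulr_ge0 ?exprn_ge0 //.
  rewrite -(bigA_distr_bigA (fun l b => f (u l) b)) /=.
  rewrite -[X in _ ^+ X]card_ord -prodr_const ler_prod // => l _.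
  rewrite sumr_ge0 => [|b _]; last by rewrite ltW.
  by rewrite grid_line_sum_le // l0.
rewrite sumr_const card_ffun !card_ord -[leLHS]mulr_natr natrX.
rewrite [leRHS](_ : _ = 3 ^+ n * ell%:R ^+ (2 * (n - d)) * (6 / c * ell%:R * G%:R) ^+ d *
   G%:R ^+ d) //.
have -> : (2 * n - d = 2 * (n - d) + d)%N by lia.
rewrite exprD !exprMn; ring.
Qed.

End Grid.

(** * Uniform energy bounds *)

(** Partial sums up to degree 4^j of order 2^(jD) are summed against a weight which is
    at most 4^(-j alpha) from degree 4^j on: the dyadic blocks decay geometrically,
    with ratio 2^(D - 2 alpha).  Scales 4^j are used so that their square roots are
    integers. *)
Lemma dyadic_sum_le (R : realType) (I : Type) (s : seq I) (deg : I -> nat) (B : I -> R)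
    (alpha K : R) (n D J : nat) : (0 < n)%N -> D%:R < 2 * alpha -> (forall k, 0 <= B k) ->
  (forall j, (j <= J)%N -> \sum_(k <- s | (deg k < (2 ^ j) ^ 2)%N) B k <= K * (2 ^ j)%:R ^+ D) ->
  \sum_(k <- s | (deg k < (2 ^ J) ^ 2)%N) (n + deg k)%:R `^ (- alpha) * B k <=
  K * (1 + 2 ^+ D / (1 - 2 `^ (D%:R - 2 * alpha))).
Proof.
move=> n0 Da B0 H; set q := 2 `^ (D%:R - 2 * alpha).
have a0 : 0 < alpha by have : 0 <= D%:R :> R by []; lra.
have q0 : 0 <= q by apply: powR_ge0.
have q1 : q < 1.
  rewrite /q -opprB powRN invf_lt1 ?powR_gt0 //.
  by rewrite -[ltLHS](congr1 (fun f => f (2 * alpha - D%:R)) (@powR1 R)) gt0_ltr_powR ?nnegrE ?subr_gt0 ?ltr1n.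
have K0 : 0 <= K.
  have := H 0%N isT; rewrite expr1n mulr1; apply: le_trans; exact: sumr_ge0.
have wle N x : 0 < x -> x <= (n + N)%:R -> (n + N)%:R `^ (- alpha) <= x `^ (- alpha).
  move=> x0 xle; rewrite !powRN lef_pV2 ?posrE ?powR_gt0 //; last exact: lt_le_trans xle.
  by apply: ge0_ler_powR; rewrite ?nnegrE // ltW.
have step : forall j, (j <= J)%N ->
    \sum_(k <- s | (deg k < (2 ^ j) ^ 2)%N) (n + deg k)%:R `^ (- alpha) * B k <=
    K * (1 + 2 ^+ D * \sum_(i < j) q ^+ i).
  elim=> [|j IH] jJ.
    rewrite big_ord0 mulr0 addr0 mulr1.
    have := H 0%N isT; rewrite expr1n mulr1; apply: le_trans.
    apply: ler_sum => k _; rewrite -[leRHS]mul1r ler_wpM2r //.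
    by rewrite -[leRHS](congr1 (fun f => f (- alpha)) (@powR1 R)) wle // ler1n addn_gt0 n0.
  rewrite big_ord_recr /=; set S := \sum_(i < j) _ in IH *.
  have -> : K * (1 + 2 ^+ D * (S + q ^+ j)) = K * (1 + 2 ^+ D * S) + K * (2 ^+ D * q ^+ j).
    by ring.
  rewrite (bigID (fun k => (deg k < (2 ^ j) ^ 2)%N)) /=; apply: lerD.
    rewrite (eq_bigl (fun k => (deg k < (2 ^ j) ^ 2)%N)); first exact: IH (ltnW jJ).
    move=> k; case: (ltnP (deg k) ((2 ^ j) ^ 2)) => h; rewrite ?andbF ?andbT //.
    by rewrite (leq_trans h) // leq_exp2r // leq_exp2l.
  apply: (@le_trans _ _ (((2 ^ j) ^ 2)%:R `^ (- alpha) *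
     \sum_(k <- s | (deg k < (2 ^ j.+1) ^ 2)%N) B k)).
    rewrite mulr_sumr [leRHS](bigID (fun k => (deg k < (2 ^ j) ^ 2)%N)) /=.
    rewrite -[leLHS]add0r lerD ?sumr_ge0 // => [k _|].
      by rewrite mulr_ge0 ?powR_ge0.
    apply: ler_sum => k /andP[_ kj]; rewrite ler_wpM2r // wle ?ltr0n ?expn_gt0 //.
    by rewrite ler_nat; lia.
  have -> : K * (2 ^+ D * q ^+ j) = ((2 ^ j) ^ 2)%:R `^ (- alpha) * (K * (2 ^ j.+1)%:R ^+ D).
    have -> : ((2 ^ j) ^ 2)%:R `^ (- alpha) = (2 `^ (- (2 * alpha))) ^+ j :> R.
      rewrite -expnM natrX -!powR_mulrn ?powR_ge0 // -!powRrM; congr (_ `^ _).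
      by rewrite natrM; ring.
    have -> : q = 2 ^+ D * 2 `^ (- (2 * alpha)).
      by rewrite /q powRD ?pnatr_eq0 ?implybT // powR_mulrn.
    by rewrite natrX exprS !exprMn -!exprM [(j * D)%N]mulnC; ring.
  by rewrite ler_wpM2l ?powR_ge0 // H.
apply: (le_trans (step J (leqnn J))); rewrite ler_wpM2l // lerD2l ler_wpM2l ?exprn_ge0 //.
rewrite -[leRHS]mul1r ler_pdivlMr ?subr_gt0 // mulrC.
have -> : (1 - q) * \sum_(i < J) q ^+ i = 1 - q ^+ J.
  by rewrite -opprB mulNr -subrX1 opprB.
by rewrite gerBl exprn_ge0.
Qed.

Section Energy.
Variable R : realType.
Local Notation C := R[i].

(** Multiplying the points by r multiplies the moments of degree N by r^N and bounds
    the kernel by (1-r)^(-n), without any information on the position of the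
    points. *)
Lemma scaled_energy_le (V : finType) n (z : V -> 'I_n -> C) (r : R) (s : seq (multinom n)) :
  (0 < n)%N -> 0 <= r -> r < 1 -> (forall v, \sum_i normc (z v i) ^+ 2 = 1) -> uniq s ->
  \sum_(k <- s) (r ^+ mdeg k) ^+ 2 *
     (szego_coef R k * normc (\sum_v \prod_(i < n) z v i ^+ k i) ^+ 2) <=
  #|V|%:R ^+ 2 * (1 - r)^-1 ^+ n.
Proof.
move=> n0 r0 r1 z1 us.
pose L := (\max_(k <- s) (mdeg k)).+1.
have sL : {in s, forall k, (mdeg k < L)%N} by move=> k ks; rewrite ltnS leq_bigmax_seq.
pose z' v i := r%:C%C * z v i.
have := szego_energy_normc_le z' n0 us sL.
have -> : \sum_(k <- s) szego_coef R k * normc (\sum_v \prod_(i < n) z' v i ^+ k i) ^+ 2 =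
  \sum_(k <- s) (r ^+ mdeg k) ^+ 2 *
     (szego_coef R k * normc (\sum_v \prod_(i < n) z v i ^+ k i) ^+ 2).
  apply: eq_bigr => k _; rewrite [RHS]mulrCA -exprMn; congr (_ * _ ^+ 2).
  have -> : \sum_v \prod_(i < n) z' v i ^+ k i =
            (r ^+ mdeg k)%:C%C * \sum_v \prod_(i < n) z v i ^+ k i.
    rewrite mulr_sumr; apply: eq_bigr => v _.
    under eq_bigr do rewrite exprMn.
    by rewrite big_split /= prodrXr -mdegE rmorphXn.
  rewrite ComplexField.Normc.normcM; congr (_ * _).
  by apply: complexI; rewrite -normcE ger0_norm // ler0c exprn_ge0.
move/le_trans; apply.
apply: (@le_trans _ _ (\sum_(u : V) \sum_(v : V) (1 - r)^-1 ^+ n)); last first.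
  by rewrite !sumr_const -mulrnA -[leLHS]mulr_natl natrM expr2.
apply: ler_sum => u _; apply: ler_sum => v _.
have r1' : 0 < 1 - r by lra.
rewrite lerXn2r ?nnegrE ?normc_ge0 ?invr_ge0 ?(ltW r1') //.
rewrite -lecR -normcE (le_trans (ler_norm_sum _ _ _)) //.
have conv y : (\sum_i normc (z y i) ^+ 2)%:C%C = \sum_i `|z y i| ^+ 2.
  by rewrite rmorph_sum; apply: eq_bigr => i _; rewrite rmorphXn /= -normcE.
have x1 : `|\sum_i z u i * (z v i)^*| <= 1 by apply: norm_inner_le1; rewrite -conv z1.
apply: (@le_trans _ _ ((\sum_(j < L) r ^+ j)%:C%C)); last first.
  rewrite lecR -[leRHS]mul1r ler_pdivlMr // mulrC.
  have -> : (1 - r) * \sum_(i < L) r ^+ i = 1 - r ^+ L.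
    by rewrite -opprB mulNr -subrX1 opprB.
  by rewrite gerBl exprn_ge0.
rewrite rmorph_sum; apply: ler_sum => j _; rewrite normrX rmorphXn.
apply: lerXn2r; rewrite ?nnegrE ?normr_ge0 ?ler0c //.
have -> : \sum_i z' u i * (z' v i)^* = (r ^+ 2)%:C%C * \sum_i z u i * (z v i)^*.
  rewrite mulr_sumr; apply: eq_bigr => i _; rewrite /z' rmorphM /=.
  have -> : (r%:C%C)^* = r%:C%C :> C.
    by apply/CrealP; rewrite ger0_real // ler0c.
  by rewrite rmorphXn /=; ring.
rewrite normrM ger0_norm ?ler0c ?exprn_ge0 //.
rewrite (le_trans (ler_wpM2l _ x1)) ?ler0c ?exprn_ge0 //.
by rewrite mulr1 lecR expr2 ler_piMl // ltW.
Qed.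

(** The bound E depends neither on r nor on the points: the degrees below G^2 contribute
    a convergent dyadic sum, and G is taken so large that the powers of r make the
    remaining degrees contribute at most 1.  The radius is r^2, one factor r being
    spent on the convergence of the tail and the other one on its smallness. *)
Lemma riesz_energy_le n d (alpha c : R) : (0 < n)%N -> (d <= n)%N -> 0 < c -> c <= 1 ->
  (2 * n - d)%:R < 2 * alpha ->
  exists E : R, forall r : R, 0 < r -> r < 1 -> exists2 G, (0 < G)%N &
  forall (z : {ffun 'I_d -> 'I_G} -> 'I_n -> C) (s : seq (multinom n)),
  (forall v, \sum_i normc (z v i) ^+ 2 = 1) ->
  (forall (u v : {ffun 'I_d -> 'I_G}) l, c * (((u l : nat)%:R - (v l : nat)%:R) / G%:R) ^+ 2 <=
     (\sum_i normc (z u i - z v i) ^+ 2) / 2) ->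
  uniq s ->
  \sum_(k <- s) (r ^+ 2 ^+ mdeg k) ^+ 2 * ((n + mdeg k)%:R `^ (- alpha) *
     (szego_coef R k * normc (\sum_v \prod_(i < n) z v i ^+ k i) ^+ 2)) <=
  E * (G%:R ^+ d) ^+ 2.
Proof.
move=> n0 dn c0 c1 ha; set D := (2 * n - d)%N in ha *.
pose K := 3 ^+ n * (6 / c) ^+ d : R.
exists (K * (1 + 2 ^+ D / (1 - 2 `^ (D%:R - 2 * alpha))) + 1) => r r0 r1.
have [J hJ] : exists J, (r ^+ ((2 ^ J) ^ 2)) ^+ 2 * (1 - r)^-1 ^+ n <= 1.
  have : (r ^+ m @[m --> \oo] --> (0 : R))%classic.
    by apply: cvg_expr; rewrite ger0_norm // ltW.
  have i0 : 0 < (1 - r) ^+ n by rewrite exprn_gt0 // subr_gt0.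
  move=> /cvgrPdist_lt /(_ _ i0)[J _ hJ]; exists J.
  rewrite exprVn ler_pdivrMr // mul1r.
  have /hJ : (J <= (2 ^ J) ^ 2)%N.
    by rewrite (leq_trans (ltnW (ltn_expl J (isT : 1 < 2)%N))) // -{1}[(2 ^ J)%N]expn1 leq_pexp2l ?expn_gt0.
  rewrite sub0r normrN ger0_norm ?exprn_ge0 ?(ltW r0) // => /ltW; apply: le_trans.
  by rewrite expr2 ler_piMl ?exprn_ge0 ?(ltW r0) // exprn_ile1 // ltW.
exists (2 ^ J)%N; first by rewrite expn_gt0.
move=> z s z1 zd us; set G := (2 ^ J)%N.
have G0 : (0 < G)%N by rewrite expn_gt0.
pose B (k : multinom n) := szego_coef R k * normc (\sum_v \prod_(i < n) z v i ^+ k i) ^+ 2.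
have B0 k : 0 <= B k by rewrite mulr_ge0 ?szego_coef_ge0 // exprn_ge0 // normc_ge0.
have a0 : 0 < alpha by have : 0 <= D%:R :> R by []; lra.
have rle1 N : r ^+ N <= 1 by rewrite exprn_ile1 // ltW.
have rge0 N : 0 <= r ^+ N by rewrite exprn_ge0 // ltW.
have w1 N : (n + N)%:R `^ (- alpha) <= 1 :> R.
  rewrite powRN invf_le1 ?powR_gt0 ?ltr0n ?addn_gt0 ?n0 //.
  by rewrite -[leLHS](powRr0 (n + N)%:R) ler_powR ?(ltW a0) // ler1n addn_gt0 n0.
rewrite (bigID (fun k => (mdeg k < G ^ 2)%N)) /= mulrDl mul1r; apply: lerD.
  apply: (@le_trans _ _ (\sum_(k <- s | (mdeg k < G ^ 2)%N)
     (n + mdeg k)%:R `^ (- alpha) * B k)).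
    apply: ler_sum => k _; rewrite -[leRHS]mul1r; apply: ler_wpM2r.
      by rewrite mulr_ge0 ?powR_ge0 ?B0.
    by rewrite -!exprM.
  rewrite mulrAC; apply: dyadic_sum_le => // j jJ.
  rewrite -big_filter.
  have := @grid_energy_le R n d G (2 ^ j) c z [seq k <- s | (mdeg k < (2 ^ j) ^ 2)%N] n0 dn c0 c1.
  rewrite expn_gt0 /= leq_exp2l // jJ => /(_ isT z1 zd).
  rewrite filter_uniq // => /(_ isT) h.
  apply: (le_trans (h _)); first by move=> k; rewrite mem_filter => /andP[].
  by rewrite /K -/D; lra.
apply: (@le_trans _ _ ((r ^+ (G ^ 2)) ^+ 2 * \sum_(k <- s) (r ^+ mdeg k) ^+ 2 * B k)).
  rewrite mulr_sumr [leRHS](bigID (fun k => (mdeg k < G ^ 2)%N)) /=.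
  rewrite -[leLHS]add0r; apply: lerD.
    apply: sumr_ge0 => k _; apply: mulr_ge0; first exact: sqr_ge0.
    by apply: mulr_ge0 => //; exact: sqr_ge0.
  apply: ler_sum => k; rewrite -leqNgt => Gk; rewrite -/(B k).
  have -> : r ^+ 2 ^+ mdeg k = r ^+ mdeg k * r ^+ mdeg k by rewrite -exprM mulnC exprM expr2.
  set x := r ^+ mdeg k; rewrite exprMn -mulrA; apply: ler_pM.
  - exact: sqr_ge0.
  - by apply: mulr_ge0; [exact: sqr_ge0|apply: mulr_ge0; rewrite ?powR_ge0].
  - by rewrite lerXn2r ?nnegrE /x // -(subnK Gk) exprD ler_piMl.
  - by apply: ler_wpM2l; [exact: sqr_ge0|rewrite -[leRHS]mul1r ler_wpM2r].
have := scaled_energy_le n0 (ltW r0) r1 z1 us.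
move=> /(ler_wpM2l (exprn_ge0 2 (rge0 (G ^ 2)%N))) /le_trans; apply.
rewrite card_ffun !card_ord natrX mulrCA -[leRHS]mulr1.
by rewrite ler_wpM2l ?exprn_ge0.
Qed.
End Energy.

(** * Charts of a submanifold *)

Section Chart.
Variable R : realType.

Lemma row_coord_norm_le n (x : 'rV[R]_n) i : `|x ord0 i| <= `|x|.
Proof.
rewrite [ `|x|]mx_normrE.
by apply: (le_bigmax _ (fun ij : 'I_1 * 'I_n => `|x ij.1 ij.2|) (ord0, i)).
Qed.

Lemma row_norm_le n (x : 'rV[R]_n) b : 0 <= b -> (forall i, `|x ord0 i| <= b) -> `|x| <= b.
Proof.
move=> b0 xb; rewrite [ `|x|]mx_normrE; apply: bigmax_le => // -[i j] _ /=.
by rewrite ord1.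
Qed.

(** A right inverse of the matrix of f bounds h by f h. *)
Lemma injective_linear_coercive d N (f : {linear 'rV[R]_d -> 'rV[R]_N}) :
  injective f -> exists2 k : R, 0 < k & forall h, k * `|h| <= `|f h|.
Proof.
move=> finj; have /row_freeP[B AB] : row_free (lin1_mx f).
  by apply: inj_row_free => v; rewrite mul_rV_lin1 => f0; apply: finj; rewrite f0 linear0.
pose K := 1 + \sum_i \sum_j `|B i j|.
have S0 : 0 <= \sum_i \sum_j `|B i j| by apply: sumr_ge0 => i _; apply: sumr_ge0.
have K0 : 0 < K by rewrite ltr_pwDl.
exists K^-1 => [|h]; first by rewrite invr_gt0.
rewrite mulrC ler_pdivrMr // -{1}[h]mulmx1 -AB mulmxA mul_rV_lin1.
apply: row_norm_le => [|j]; first by rewrite mulr_ge0 // ltW.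
rewrite mxE (le_trans (ler_norm_sum _ _ _)) // mulrDr mulr1 ler_wpDl // mulr_sumr.
apply: ler_sum => i _; rewrite normrM ler_pM //; first exact: row_coord_norm_le.
by rewrite (bigD1 j) //= lerDl sumr_ge0.
Qed.

(** Used to compare differentials at two points, given that their values on the
    canonical basis are close. *)
Lemma linear_sub_norm_le d N (f g : {linear 'rV[R]_d -> 'rV[R]_N}) (eta : R) :
  (forall i, `|f (delta_mx ord0 i) - g (delta_mx ord0 i)| <= eta) ->
  forall h, `|f h - g h| <= d%:R * eta * `|h|.
Proof.
move=> fg h.
have E (F : {linear 'rV[R]_d -> 'rV[R]_N}) : F h = \sum_(i < d) h ord0 i *: F (delta_mx ord0 i).
  by rewrite {1}[h]row_sum_delta linear_sum; apply: eq_bigr => i _; rewrite linearZ.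
rewrite (E f) (E g) -sumrB.
rewrite (le_trans (ler_norm_sum _ _ _)) //.
apply: (@le_trans _ _ (\sum_(i < d) `|h| * eta)).
  apply: ler_sum => i _; rewrite -scalerBr normrZ ler_pM //.
  exact: row_coord_norm_le.
by rewrite sumr_const card_ord -[leLHS]mulr_natl mulrCA mulrC.
Qed.

(** The point t depends on the coordinate j, since the mean value theorem fails for
    vector-valued functions; this suffices for the maximum norm. *)
Lemma segment_mean_value d N (f : 'rV[R]_d -> 'rV[R]_N) (u h : 'rV[R]_d) j :
  (forall t : R, 0 <= t <= 1 -> differentiable f (u + t *: h)) ->
  exists2 t : R, 0 <= t <= 1 &
    (f (u + h) - f u) ord0 j = 'd f (u + t *: h) h ord0 j.
Proof.
move=> fd; pose line t : 'rV[R]_d := u + t *: h.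
have lined (t : R) : is_diff t line ( *:%R ^~ h).
  have -> : line = cst u + ( *:%R ^~ h) by [].
  have := is_diffD (is_diff_cst u t) (is_diff_scalel t h); rewrite add0r; exact.
pose g t := f (line t) ord0 j.
have gd (t : R) : 0 <= t <= 1 -> is_derive t (1 : R) g ('d f (line t) h ord0 j).
  move=> t01; have ld : differentiable line t by apply: ex_diff.
  have fld := fd _ t01.
  have cd : differentiable (fun M : 'rV[R]_N => M ord0 j : R) (f (line t)).
    exact: differentiable_coord.
  have fl : differentiable (f \o line) t by apply: differentiable_comp.
  have gdiff : differentiable g t by apply: (differentiable_comp fl cd).
  apply: DeriveDef; first exact: diff_derivable.
  rewrite deriveE // (diff_comp fl cd) /= diff_comp // /=.
  have [_ ->] := lined t; rewrite scale1r.
  have @c : {linear 'rV[R]_N -> R}.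
    by exists (fun M : 'rV[R]_N => M ord0 j); do 2![eexists]; do ?[constructor];
      rewrite ?mxE// => ? *; rewrite ?mxE//; move=> ?; rewrite !mxE.
  have -> : (fun M : 'rV[R]_N => M ord0 j : R) = c by [].
  rewrite diff_lin //; exact: coord_continuous.
have [||t] := @MVT_segment R g (fun t => 'd f (line t) h ord0 j) 0 1 ler01.
- by move=> t; rewrite in_itv /= => /andP[t0 t1]; apply: gd; rewrite !ltW.
- apply: derivable_within_continuous => t; rewrite in_itv /= => t01.
  exact: (@ex_derive _ _ _ _ _ _ _ (gd _ t01)).
rewrite in_itv /= => t01 e; exists t => //.
by rewrite !mxE; move: e; rewrite /g /line scale1r scale0r addr0 subr0 mulr1.
Qed.

(** Near a point, an immersion differs from its differential there by a Lipschitz map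
    with a small constant, and this injective linear differential expands distances
    by at least a fixed factor.  The chart is rescaled to be defined on the unit
    ball. *)
Lemma submanifold_bilipschitz_chart N d (M : set 'rV[R]_N) : submanifold d M ->
  exists (phi : 'rV[R]_d -> 'rV[R]_N) (c : R), 0 < c /\
  forall u v, `|u| <= 1 -> `|v| <= 1 -> M (phi u) /\ c * `|u - v| <= `|phi u - phi v|.
Proof.
move=> [[x Mx] /(_ x Mx)[U [W [psi [chi [[_ Ux] [Wo psiW] smooth inj _]]]]]].
have [w0 Ww0 _] : (psi @` W) x by rewrite psiW.
have [k k0 kle] := injective_linear_coercive (inj w0 Ww0).
have [psid psiC] := smooth 2%N.
have psic : forall i : 'I_d, {for w0, continuous (fun w => 'D_(delta_mx ord0 i) psi w)}.
  by move=> i; have [D _] := psiC (delta_mx ord0 i); apply/differentiable_continuous/D.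
(* Chosen so that the error d * eta on the differential is at most k / 2. *)
pose eta := k / (2 * (d%:R + 1)).
have d1 : 0 < d%:R + 1 :> R by rewrite ltr_wpDl.
have eta0 : 0 < eta by rewrite divr_gt0 // mulr_gt0.
have near_w0 : \forall w \near w0, W w /\
    forall i : 'I_d, `|'D_(delta_mx ord0 i) psi w0 - 'D_(delta_mx ord0 i) psi w| <= eta.
  apply: filterI; first exact: open_nbhs_nbhs.
  apply: (@filter_forall _ _ (fun (i : 'I_d) w =>
    `|'D_(delta_mx ord0 i) psi w0 - 'D_(delta_mx ord0 i) psi w| <= eta) _ (nbhs_filter w0)) => i.
  by have /cvgrPdist_le := psic i; apply.
have [e /= e0 eball] := (nbhs_ballP _ _).1 near_w0.
pose rho := e / 2; have rho0 : 0 < rho by rewrite divr_gt0.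
have inball u : `|u| <= 1 -> ball w0 e (w0 + rho *: u).
  move=> u1; rewrite -ball_normE /= opprD addNKr normrN normrZ (gtr0_norm rho0).
  rewrite (@le_lt_trans _ _ rho) //; first by rewrite ler_piMr // ltW.
  by rewrite /rho; lra.
exists (fun u => psi (w0 + rho *: u)), (k / 2 * rho); split; first by rewrite !mulr_gt0.
move=> u v u1 v1; split.
  have [Wu _] := eball _ (inball _ u1).
  have : (M `&` U) (psi (w0 + rho *: u)) by rewrite -psiW; exists (w0 + rho *: u).
  by case.
pose h := rho *: (u - v).
have hE : w0 + rho *: u = w0 + rho *: v + h by apply/rowP => i; rewrite !mxE; ring.
have hn : `|h| = rho * `|u - v| by rewrite normrZ gtr0_norm.
rewrite -mulrA -hn hE.
set P := psi _ - psi _.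
have bound : `|P - 'd psi w0 h| <= k / 2 * `|h|.
  apply: row_norm_le => [|j]; first by rewrite mulr_ge0 // divr_ge0 // ltW.
  have seg t : 0 <= t <= 1 -> ball w0 e (w0 + rho *: v + t *: h).
    move=> /andP[t0 t1].
    have -> : w0 + rho *: v + t *: h = w0 + rho *: ((1 - t) *: v + t *: u).
      by apply/rowP => i; rewrite !mxE; ring.
    apply: inball; rewrite (le_trans (ler_normD _ _)) // !normrZ !ger0_norm ?subr_ge0 //.
    have : (1 - t) * `|v| <= 1 - t by rewrite ler_piMr // subr_ge0.
    have : t * `|u| <= t by rewrite ler_piMr.
    lra.
  have [|t t01 tE] := @segment_mean_value d N psi (w0 + rho *: v) h j.
    by move=> t t01; apply: psid; have [] := eball _ (seg _ t01).
  have [Wt etaw] := eball _ (seg _ t01).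
  set w := w0 + rho *: v + t *: h in tE Wt etaw.
  rewrite mxE tE mxE -[X in `|X|]opprB normrN.
  have -> : 'd psi w0 h ord0 j - 'd psi w h ord0 j = ('d psi w0 h - 'd psi w h) ord0 j by rewrite !mxE.
  rewrite (le_trans (row_coord_norm_le _ _)) //.
  have etad i : `|'d psi w0 (delta_mx ord0 i) - 'd psi w (delta_mx ord0 i)| <= eta.
    by have := etaw i; rewrite !deriveE //; exact: psid.
  apply: (le_trans (linear_sub_norm_le etad h)); rewrite ler_wpM2r //.
  rewrite /eta mulrA ler_pdivrMr ?mulr_gt0 //.
  have -> : k / 2 * (2 * (d%:R + 1)) = k * d%:R + k by field.
  by rewrite mulrC lerDl ltW.
have := kle h; have : `|'d psi w0 h| <= `|P| + `|P - 'd psi w0 h|.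
  by rewrite -[X in `|X| <= _](subKr P) (le_trans (ler_normB _ _)).
lra.
Qed.

End Chart.

(** * Dirichlet-type spaces *)

Section Space.
Variables (R : realType) (n : nat).
Local Notation C := (Cplx R).

Lemma partial_sumE (V : zmodType) (x : multinom n -> V) (A : {fset multinom n}) :
  partial_sum x A = \sum_(k <- A) x k.
Proof. by rewrite /partial_sum (big_seq_fsetE _ A xpredT x). Qed.

(** The Szego coefficients are, up to the power of n + |k|, the inverses of the weights:
    this is why the dual norm of a functional is an energy of the Szego kernel. *)
Lemma dirichlet_weightV (alpha : R) (k : multinom n) : (0 < n)%N ->
  dirichlet_weight alpha k * ((n + mdeg k)%:R `^ (- alpha) * szego_coef R k) = 1.
Proof.
move=> n0; rewrite /dirichlet_weight /szego_coef powRN.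
set P := (\prod_(i < n) (k i)`!)%N; set w := _ `^ alpha.
have w0 : w != 0 by rewrite gt_eqF // powR_gt0 // ltr0n addn_gt0 n0.
have P0 : P%:R != 0 :> R by rewrite pnatr_eq0 -lt0n prodn_gt0 // => i; rewrite fact_gt0.
have := @bin_fact (mdeg k + n.-1) n.-1 (leq_addl _ _).
rewrite addnK addnC => /(congr1 (fun N => N%:R : R)); rewrite !natrM => e.
rewrite -e; field.
by rewrite w0 P0 !pnatr_eq0 -!lt0n !fact_gt0 bin_gt0 leq_addr.
Qed.

Lemma dirichlet_weight_gt0 (alpha : R) (k : multinom n) : (0 < n)%N ->
  0 < dirichlet_weight alpha k.
Proof.
move=> n0; rewrite divr_gt0 ?ltr0n ?fact_gt0 // mulr_gt0 ?powR_gt0 ?ltr0n ?addn_gt0 ?n0 //.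
by rewrite muln_gt0 fact_gt0 prodn_gt0 // => i; rewrite fact_gt0.
Qed.

Lemma coef_norm_partial (alpha eps : R) (a : multinom n -> C) (A : {fset multinom n}) :
  (0 < n)%N -> 0 < eps -> (coef_norm alpha a < eps%:E)%E ->
  \sum_(k <- A) dirichlet_weight alpha k * normc (a k) ^+ 2 <= eps ^+ 2.
Proof.
move=> n0 e0; rewrite /coef_norm; set S := esum _ _ => Se.
have t0 k : 0 <= dirichlet_weight alpha k * normc (a k) ^+ 2.
  by rewrite mulr_ge0 ?exprn_ge0 ?normc_ge0 // ltW // dirichlet_weight_gt0.
have S0 : (0 <= S)%E by apply: esum_ge0 => k _; rewrite lee_fin.
have Sle : (S <= (eps ^+ 2)%:E)%E.
  rewrite -(@lee_sqrt _ S) ?lee_fin ?exprn_ge0 ?ltW //.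
  by rewrite /= sqrtr_sqr gtr0_norm // ltW.
rewrite -lee_fin; apply: le_trans Sle; apply: esum_ge.
exists [set` A]; first by split => //; exact: finite_fset.
by rewrite fsbig_finite ?finite_fset //= set_fsetK sumEFin.
Qed.

Lemma one_in_dirichlet_space (alpha : R) : (0 < n)%N ->
  @dirichlet_space R n alpha (fun=> 1).
Proof.
move=> n0; split; first by move=> z _; apply: (differentiable_cst (1 : C) z).
pose a (k : multinom n) : C := (k == mnm0)%:R.
apply: (@le_lt_trans _ _ (coef_norm alpha a)).
  apply: ereal_inf_lbound; exists a => // z _.
  have near1 : totally [set A | partial_sum (fun k => a k * zmonom k z) A = 1].
    exists [fset (@mnm0 n)]%fset => //= A /= sA.
    have mA : mnm0 \in A by rewrite (fsubsetP sA) // inE.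
    rewrite partial_sumE (bigD1_seq mnm0) ?fset_uniq //= big1 => [|k k0].
      rewrite addr0 /a eqxx mul1r /zmonom big1 // => i _.
      by rewrite mnm0E expr0.
    by rewrite /a (negbTE k0) mul0r.
  exact: cvg_near_cst near1.
rewrite /coef_norm.
have -> : (\esum_(k in [set: multinom n])
    (dirichlet_weight alpha k * normc (a k) ^+ 2)%:E = (dirichlet_weight alpha (@mnm0 n))%:E)%E.
  transitivity (\esum_(k in [set mnm0]) (dirichlet_weight alpha k * normc (a k) ^+ 2)%:E)%E.
    rewrite [RHS]esum_mkcond; apply: eq_esum => k _.
    case: ifPn => // /negP kn; rewrite /a; case: eqP => [e|_].
      by exfalso; apply: kn; rewrite inE /= e.
    by rewrite ComplexField.Normc.normc0 expr0n mulr0.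
  rewrite esum_set1.
    by rewrite /a eqxx ComplexField.Normc.normc1 expr1n mulr1.
  by rewrite lee_fin mulr_ge0 ?exprn_ge0 ?normc_ge0 // ltW // dirichlet_weight_gt0.
by rewrite ltey.
Qed.

Lemma zmonom_scale (k : multinom n) (rho : C) (z : 'rV[C]_n) :
  zmonom k (rho *: z) = rho ^+ mdeg k * zmonom k z.
Proof.
rewrite /zmonom; under eq_bigr do rewrite mxE exprMn.
by rewrite big_split /= prodrXr -mdegE.
Qed.

Lemma enorm1P (z : 'rV[C]_n) : enorm z = 1 -> \sum_i normc (z ord0 i) ^+ 2 = 1.
Proof.
move=> z1; rewrite -[LHS]sqr_sqrtr ?[Num.sqrt _]z1 ?expr1n //.
by apply: sumr_ge0 => i _; rewrite exprn_ge0 ?normc_ge0.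
Qed.

Lemma zmonom_le1 (k : multinom n) (z : 'rV[C]_n) : enorm z = 1 -> `|zmonom k z| <= 1.
Proof.
move=> /enorm1P z1; rewrite normr_prod; apply: prodr_ile1 => i _.
rewrite normr_ge0 normrX exprn_ile1 //.
rewrite [leLHS]normcE lecR -(@expr_le1 _ 2) ?normc_ge0 // -z1.
rewrite (bigD1 i) //= lerDl; apply: sumr_ge0 => j _; by rewrite exprn_ge0 ?normc_ge0.
Qed.

Lemma peval_zmonom (p : mpoly n C) z :
  peval p z = \sum_(k <- msupp p) mcoeff k p * zmonom k z.
Proof. by rewrite /peval mevalE. Qed.

Lemma one_sub_exp_le (F : numDomainType) (x : F) N : 0 <= x -> x <= 1 ->
  1 - x ^+ N <= N%:R * (1 - x).
Proof.
move=> x0 x1; rewrite -opprB subrX1 -mulNr opprB mulrC ler_wpM2r ?subr_ge0 //.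
rewrite (le_trans (ler_sum _ (G := fun=> 1) _)) ?sumr_const ?card_ord // => i _.
exact: exprn_ile1.
Qed.

(** At a zero z of p on the sphere, p (rho z) - p (z) is at most a constant times
    1 - rho, and the constant depends only on the coefficients of p. *)
Lemma monomial_span_radial_le (p : mpoly n C) h : monomial_span (peval p) h ->
  exists2 K : R, 0 <= K & forall (z : 'rV[C]_n) (rho : R), 0 <= rho -> rho <= 1 ->
   enorm z = 1 -> peval p z = 0 -> normc (h (rho%:C%C *: z)) <= K * (1 - rho).
Proof.
case=> s ->; pose L := \sum_(k <- msupp p) normc (mcoeff k p) * (mdeg k)%:R.
have L0 : 0 <= L by apply: sumr_ge0 => k _; rewrite mulr_ge0 ?normc_ge0.
pose S := \sum_(ck <- s) normc ck.1.
have S0 : 0 <= S by apply: sumr_ge0 => k _; rewrite normc_ge0.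
exists (S * L) => [|z rho rho0 rho1 z1 pz]; first by rewrite mulr_ge0.
have rC0 : 0 <= rho%:C%C :> C by rewrite ler0c.
have rC1 : rho%:C%C <= 1 :> C by rewrite (_ : 1 = 1%:C%C) // lecR.
have pz_le : `|peval p (rho%:C%C *: z)| <= (L * (1 - rho))%:C%C.
  rewrite -[peval _ _]subr0 -{1}pz !peval_zmonom -sumrB (le_trans (ler_norm_sum _ _ _)) //.
  rewrite /L mulr_suml rmorph_sum; apply: ler_sum => k _.
  rewrite zmonom_scale -mulrBr normrM -{2}[zmonom k z]mul1r -mulrBl normrM.
  rewrite -mulrA rmorphM /= -normcE; apply: ler_wpM2l => //.
  rewrite -[leRHS]mulr1; apply: ler_pM; rewrite ?zmonom_le1 //.
  rewrite distrC ger0_norm ?subr_ge0 ?exprn_ile1 //.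
  rewrite rmorphM rmorph_nat rmorphB rmorph1; exact: one_sub_exp_le.
rewrite -lecR -normcE (le_trans (ler_norm_sum _ _ _)) //.
rewrite /S -mulrA mulr_suml rmorph_sum; apply: ler_sum => ck _.
rewrite normrM rmorphM /= -normcE; apply: ler_wpM2l => //.
rewrite normrM -[leRHS]mul1r; apply: ler_pM => //.
rewrite zmonom_scale normrM mulr_ile1 ?zmonom_le1 // normrX exprn_ile1 //.
by rewrite ger0_norm.
Qed.

(** Charts are measured in the maximum norm of the real coordinates, and the kernel in
    the Euclidean norm. *)
Lemma realify_dist_le (z w : 'rV[C]_n) :
  `|realify z - realify w| ^+ 2 <= \sum_i normc (z ord0 i - w ord0 i) ^+ 2.
Proof.
set S := \sum_i _.
have S0 : 0 <= S by apply: sumr_ge0 => i _; rewrite exprn_ge0 ?normc_ge0.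
have term i : normc (z ord0 i - w ord0 i) ^+ 2 <= S.
  by rewrite /S (bigD1 i) //= lerDl sumr_ge0 // => j _; rewrite exprn_ge0 ?normc_ge0.
suff : `|realify z - realify w| <= Num.sqrt S.
  by move=> h; rewrite -[S]sqr_sqrtr // lerXn2r ?nnegrE ?sqrtr_ge0.
apply: row_norm_le => [|j]; first exact: sqrtr_ge0.
rewrite -sqrtr_sqr ler_sqrt //.
have sub2 (x y : C) : (complex.Re x - complex.Re y) ^+ 2 <= normc (x - y) ^+ 2 /\
    (complex.Im x - complex.Im y) ^+ 2 <= normc (x - y) ^+ 2.
  case: x y => [x1 x2] [y1 y2] /=; rewrite sqr_sqrtr ?addr_ge0 ?sqr_ge0 //.
  by rewrite lerDl lerDr !sqr_ge0.
rewrite /realify !mxE; case: (fintype.split j) => i; rewrite !mxE.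
  exact: le_trans (sub2 _ _).1 (term i).
exact: le_trans (sub2 _ _).2 (term i).
Qed.

End Space.

(** * Multiples of p stay away from the constant 1 *)

Section Noncyclicity.
Variables (R : realType) (n : nat).
Local Notation C := (Cplx R).

Lemma enorm_scale (rho : R) (z : 'rV[C]_n) : 0 <= rho ->
  enorm (rho%:C%C *: z) = rho * enorm z.
Proof.
move=> r0; rewrite /enorm.
have -> : \sum_(i < n) normc ((rho%:C%C *: z) ord0 i) ^+ 2 =
          rho ^+ 2 * \sum_(i < n) normc (z ord0 i) ^+ 2.
  rewrite mulr_sumr; apply: eq_bigr => i _; rewrite mxE ComplexField.Normc.normcM exprMn.
  congr (_ ^+ 2 * _); apply: complexI; rewrite -normcE ger0_norm // ler0c //.
by rewrite sqrtrM ?sqr_ge0 // sqrtr_sqr ger0_norm.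
Qed.

(** The Cauchy-Schwarz inequality between the weights and their inverses, in the form of
    a sum of arithmetic-geometric inequalities with a free parameter t. *)
Lemma dual_pairing_le (alpha t eps E : R) (a b : multinom n -> C) (A : {fset multinom n}) :
  (0 < n)%N -> 0 < t ->
  \sum_(k <- A) dirichlet_weight alpha k * normc (a k) ^+ 2 <= eps ->
  \sum_(k <- A) (n + mdeg k)%:R `^ (- alpha) * szego_coef R k * normc (b k) ^+ 2 <= E ->
  `|\sum_(k <- A) a k * b k| <= (t / 2 * eps + (2 * t)^-1 * E)%:C%C.
Proof.
move=> n0 t0 ha hb; rewrite (le_trans (ler_norm_sum _ _ _)) //.
apply: (@le_trans _ _ (t / 2 * (\sum_(k <- A) dirichlet_weight alpha k * normc (a k) ^+ 2) +
  (2 * t)^-1 * (\sum_(k <- A) (n + mdeg k)%:R `^ (- alpha) * szego_coef R k * normc (b k) ^+ 2))%:C%C).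
  rewrite !mulr_sumr -big_split rmorph_sum; apply: ler_sum => k _ /=.
  rewrite normrM !normcE -rmorphM lecR.
  have w0 := dirichlet_weight_gt0 alpha k n0.
  have /(congr1 (fun x => (dirichlet_weight alpha k)^-1 * x)) := dirichlet_weightV alpha k n0.
  rewrite mulKf ?gt_eqF // mulr1 => ->.
  move: (normc (a k)) (normc (b k)) (dirichlet_weight _ _) w0 => x y w w0.
  have -> : t / 2 * (w * x ^+ 2) + (2 * t)^-1 * (w^-1 * y ^+ 2) =
     x * y + (2 * t * w)^-1 * (t * w * x - y) ^+ 2.
    by field; rewrite !gt_eqF.
  by rewrite lerDl mulr_ge0 ?sqr_ge0 // invr_ge0 !mulr_ge0 // ltW.
by rewrite lecR lerD // ler_wpM2l // ?invr_ge0 ?divr_ge0 ?mulr_ge0 // ltW.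
Qed.

(** The function 1 is compared with a polynomial multiple h of p close to it.  Summed
    over the grid points, 1 is the sum of h, which is small there, of 1 - h minus a
    partial sum of its expansion, which is small by convergence, and of this partial
    sum, which is small by duality: each contributes at most a quarter of the number
    of points. *)
Lemma noncyclic_of_submanifold (p : mpoly n C) (alpha : R) d (M : set 'rV[R]_(n + n)) :
  (0 < n)%N -> (d <= n)%N -> submanifold d M ->
  M `<=` @realify R n @` (zero_set p `&` @csphere R n) ->
  (2 * n - d)%:R < 2 * alpha -> ~ cyclic_vector alpha (peval p).
Proof.
move=> n0 dn Msub Mp ha cyc.
have [_] : dirichlet_closure alpha (monomial_span (peval p)) (fun=> 1).
  by rewrite cyc; exact: one_in_dirichlet_space.
have [phi [c0 [c00 chart]]] := submanifold_bilipschitz_chart Msub.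
have /choice[zc hzc] : forall u : 'rV[R]_d, exists z : 'rV[C]_n, `|u| <= 1 ->
    [/\ peval p z = 0, enorm z = 1 & realify z = phi u].
  move=> u; have [u1|/negP u1] := boolP (`|u| <= 1); last by exists 0.
  have [Mu _] := chart u u u1 u1.
  by have [z [zp zs] zE] := Mp _ Mu; exists z.
pose c := Num.min 1 (c0 ^+ 2 / 2).
have cpos : 0 < c by rewrite lt_min ltr01 divr_gt0 ?exprn_gt0.
have c1 : c <= 1 by rewrite ge_min lexx.
have cc0 : c <= c0 ^+ 2 / 2 by rewrite ge_min lexx orbT.
have [E hE] := riesz_energy_le n0 dn cpos c1 ha.
(* With t = tau * V in the duality bound, both halves of it are at most V / 8. *)
pose E' := `|E| + 1; pose tau := 4 * E'; pose eps := (4 * tau)^-1.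
have E'1 : 1 <= E' by rewrite lerDr.
have EE' : E <= E' by rewrite (le_trans (ler_norm E)) // lerDl.
have tau0 : 0 < tau by rewrite mulr_gt0 // (lt_le_trans _ E'1).
have eps0 : 0 < eps by rewrite invr_gt0 mulr_gt0.
move=> /(_ eps eps0)[h hspan].
move=> /ereal_inf_lt[_ [a aexp <-] anorm].
have [K K0 hK] := monomial_span_radial_le hspan.
(* Chosen so that |h| <= 1/4 at radius r^2 on the zeros of p. *)
pose r := 1 - (8 * (K + 1))^-1.
have K1 : 0 < K + 1 by rewrite ltr_wpDl.
have q0 : 0 < (8 * (K + 1))^-1 by rewrite invr_gt0 mulr_gt0.
have q1 : (8 * (K + 1))^-1 <= 8^-1.
  by rewrite lef_pV2 ?posrE ?mulr_gt0 // ler_peMr // lerDr.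
have r0 : 0 < r by rewrite /r; lra.
have r1 : r < 1 by rewrite /r; lra.
have Kr : K * (1 - r ^+ 2) <= 4^-1.
  have e : (K + 1) * (8 * (K + 1))^-1 = 8^-1 by field; rewrite gt_eqF.
  have : 1 - r ^+ 2 <= 2 * (8 * (K + 1))^-1 by rewrite /r; set q := _^-1; nra.
  by move: q0 e; set q := (8 * (K + 1))^-1 => q0' e hq; nra.
have [G G0 hG] := hE r r0 r1.
pose grid (v : {ffun 'I_d -> 'I_G}) : 'rV[R]_d := \row_l ((v l : nat)%:R / G%:R).
have GR : 0 < G%:R :> R by rewrite ltr0n.
have grid1 v : `|grid v| <= 1.
  apply: row_norm_le => // l; rewrite mxE ger0_norm ?divr_ge0 //.
  by rewrite ler_pdivrMr // mul1r ler_nat ltnW.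
pose zeta v := zc (grid v).
have zeta0 v : peval p (zeta v) = 0 by have [] := hzc _ (grid1 v).
have zeta1 v : enorm (zeta v) = 1 by have [] := hzc _ (grid1 v).
pose z v i := zeta v ord0 i.
have z1 v : \sum_i normc (z v i) ^+ 2 = 1 by apply: enorm1P.
have zdist (u v : {ffun 'I_d -> 'I_G}) l :
    c * (((u l : nat)%:R - (v l : nat)%:R) / G%:R) ^+ 2 <=
     (\sum_i normc (z u i - z v i) ^+ 2) / 2.
  have [_ _ eu] := hzc _ (grid1 u); have [_ _ ev] := hzc _ (grid1 v).
  have := realify_dist_le (zeta u) (zeta v); rewrite eu ev => hle.
  have [_ hc] := chart _ _ (grid1 u) (grid1 v).
  have hl := row_coord_norm_le (grid u - grid v) l.
  have -> : (((u l : nat)%:R - (v l : nat)%:R) / G%:R) = (grid u - grid v) ord0 l :> R.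
    by rewrite !mxE mulrBl.
  rewrite ler_pdivlMr // (le_trans _ hle) // -real_normK ?num_real //.
  set S := `|(grid u - grid v) ord0 l| ^+ 2; have S0 : 0 <= S by exact: sqr_ge0.
  have h1 : S <= `|grid u - grid v| ^+ 2 by rewrite lerXn2r ?nnegrE.
  have : (c0 * `|grid u - grid v|) ^+ 2 <= `|phi (grid u) - phi (grid v)| ^+ 2.
    by rewrite lerXn2r ?nnegrE ?mulr_ge0 // ltW.
  rewrite exprMn; apply: le_trans.
  apply: (@le_trans _ _ (c0 ^+ 2 * S)); last by rewrite ler_wpM2l ?sqr_ge0.
  rewrite mulrAC ler_wpM2r //.
  by rewrite -ler_pdivlMr.
have {}hG s := hG z s z1 zdist.
pose rho : C := (r ^+ 2)%:C%C.
have r20 : 0 <= r ^+ 2 by exact: sqr_ge0.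
have r21 : r ^+ 2 < 1 by rewrite expr_lt1 // ltW.
have inball v : cball (rho *: zeta v).
  by rewrite /cball /= /rho enorm_scale // zeta1 mulr1.
have near_v : \forall A \near totally, forall v : {ffun 'I_d -> 'I_G},
    `|(1 - h (rho *: zeta v)) - partial_sum (fun k => a k * zmonom k (rho *: zeta v)) A| <
    (4^-1 : R)%:C%C.
  apply: (@filter_forall _ _ (fun (v : {ffun 'I_d -> 'I_G}) (A : {fset multinom n}) =>
    `|(1 - h (rho *: zeta v)) - partial_sum (fun k => a k * zmonom k (rho *: zeta v)) A| <
    (4^-1 : R)%:C%C) totally _) => v.
  have /cvgrPdist_lt := aexp _ (inball v); apply.
  by rewrite (_ : 0 = (0 : R)%:C%C) // ltcR invr_gt0.
have [A hA] := filter_ex near_v.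
pose b k := \sum_v rho ^+ mdeg k * \prod_(i < n) z v i ^+ k i.
have Tsum : \sum_v partial_sum (fun k => a k * zmonom k (rho *: zeta v)) A =
            \sum_(k <- A) a k * b k.
  under eq_bigr do rewrite partial_sumE.
  rewrite exchange_big; apply: eq_bigr => k _ /=.
  by rewrite -mulr_sumr; congr (_ * _); apply: eq_bigr => v _; rewrite zmonom_scale.
pose V : R := G%:R ^+ d.
have V0 : 0 < V by rewrite exprn_gt0.
have Tle : `|\sum_(k <- A) a k * b k| <= (V / 4)%:C%C.
  have tV0 : 0 < V * tau by rewrite mulr_gt0.
  have := dual_pairing_le n0 tV0 (coef_norm_partial A n0 eps0 anorm).
  move=> /(_ (E' * V ^+ 2) b) hT; apply: (le_trans (hT _)).
    apply: (@le_trans _ _ (E * V ^+ 2)); last by rewrite ler_wpM2r ?sqr_ge0.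
    apply: le_trans (hG _ (fset_uniq A)); rewrite le_eqVlt; apply/orP; left; apply/eqP.
    apply: eq_bigr => k _; rewrite /b -mulr_sumr ComplexField.Normc.normcM exprMn.
    have -> : normc (rho ^+ mdeg k) = r ^+ 2 ^+ mdeg k.
      rewrite /rho -rmorphXn; apply: complexI; rewrite -normcE ger0_norm // ler0c exprn_ge0 //.
    ring.
  rewrite lecR.
  have -> : (2 * (V * tau))^-1 * (E' * V ^+ 2) = V / 8.
    by rewrite /tau; field; rewrite !gt_eqF // (lt_le_trans _ E'1).
  have -> : V * tau / 2 * eps ^+ 2 = V / 8 * eps.
    by rewrite /eps; field; rewrite gt_eqF.
  have : eps <= 1.
    by rewrite /eps invf_le1 ?mulr_gt0 // /tau; lra.
  nra.
have cardV : \sum_(v : {ffun 'I_d -> 'I_G}) (1 : C) = V%:C%C.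
  by rewrite sumr_const card_ffun !card_ord /V -natrX rmorph_nat.
have : V%:C%C <= (V / 4 + V / 4 + V / 4)%:C%C :> C.
  have sumq : \sum_(v : {ffun 'I_d -> 'I_G}) (4^-1 : R)%:C%C = (V / 4)%:C%C :> C.
    by rewrite rmorphM /= -cardV mulr_suml; apply: eq_bigr => v _; rewrite mul1r.
  have split3 : V%:C%C = \sum_v h (rho *: zeta v) +
     \sum_v ((1 - h (rho *: zeta v)) - partial_sum (fun k => a k * zmonom k (rho *: zeta v)) A) +
     \sum_(k <- A) a k * b k.
    rewrite -cardV -Tsum -!big_split; apply: eq_bigr => v _ /=; ring.
  have V0' : 0 <= V%:C%C :> C by rewrite ler0c ltW.
  rewrite -(ger0_norm V0') split3 !rmorphD /=.
  rewrite (le_trans (ler_normD _ _)) // lerD //.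
  rewrite (le_trans (ler_normD _ _)) // lerD // -sumq (le_trans (ler_norm_sum _ _ _)) //.
    apply: ler_sum => v _; rewrite normcE lecR.
    by apply: le_trans Kr; apply: hK => //; apply: ltW.
  by apply: ler_sum => v _; apply: ltW.
by rewrite lecR; lra.
Qed.

End Noncyclicity.

(** With d = m - 1, the threshold n - d/2 is (2 n - (m - 1)) / 2. *)
Theorem theorem3 (R : realType) (n m : nat) (p : mpoly n (Cplx R))
  (alpha : R) (hn : (2 <= n)%N) (hm : (2 <= m <= n)%N)
  (hp : forall z : 'rV[Cplx R]_n, cball z -> peval p z <> 0)
  (hsub : exists2 M : set 'rV[R]_(n + n), submanifold (m - 1) M &
     M `<=` @realify R n @` (zero_set p `&` @csphere R n))
  (hmax : forall d : nat, (m - 1 < d)%N ->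
     ~ exists2 M : set 'rV[R]_(n + n), submanifold d M &
       M `<=` @realify R n @` (zero_set p `&` @csphere R n))
  (halpha : (2 * n%:R - (m%:R - 1)) / 2 < alpha) :
  ~ cyclic_vector alpha (peval p).
Proof.
have [M Msub Mp] := hsub; case/andP: hm => m2 mn.
have n0 : (0 < n)%N by apply: ltnW.
have dn : (m - 1 <= n)%N by apply: leq_trans (leq_subr 1 m) mn.
apply: (noncyclic_of_submanifold n0 dn Msub Mp).
rewrite natrB; last by rewrite (leq_trans dn) // leq_pmull.
rewrite natrM natrB ?(ltnW m2) //; lra.
Qed.
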